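(* Let $M,N,L\ge1$ be integers, $\alpha_{\rm s}>0$, $p>0$, and let $\mathbf h_{\rm s}\in\mathbb C^{M\times1}$ be a fixed nonzero vector. The sensing rate achieved by the sensing-centric design, i.e. the value $\mathcal R_{\rm s}^{\rm s}$ of $\mathcal R_{\rm s}(\mathbf w)=L^{-1}\log_2(1+pNL\alpha_{\rm s}|\mathbf w^{\mathsf H}\mathbf h_{\rm s}|^2)$ at the beamformer $\mathbf w_{\rm s}=\mathbf h_{\rm s}/\lVert\mathbf h_{\rm s}\rVert$ that maximizes $\mathcal R_{\rm s}(\mathbf w)$ over unit-norm $\mathbf w\in\mathbb C^{M\times1}$, is $$\mathcal R_{\rm s}^{\rm s}=L^{-1}\log_2(1+pNL\alpha_{\rm s}\lVert\mathbf h_{\rm s}\rVert^2).$$ Moreover, as $p\to\infty$, $$\mathcal R_{\rm s}^{\rm s}\approx L^{-1}\left(\log_2p+\log_2\!\left(NL\alpha_{\rm s}\lVert\mathbf h_{\rm s}\rVert^2\right)\right).$$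
   Context: A base station with $M$ transmit and $N$ receive antennas sends a length-$L$ signal $\sqrt p\,\mathbf w\mathbf s^{\mathsf H}$ with power budget $p$ and unit-norm beamformer $\mathbf w$, sensing one target of average reflection strength $\alpha_{\rm s}$. The sensing rate of beamformer $\mathbf w$ is $\mathcal R_{\rm s}(\mathbf w)$ as in the claim, where $\mathbf h_{\rm s}$ is the (deterministic, nonzero) transmit array steering vector toward the target. For rates, ''$\approx$ as $p\to\infty$'' means that the difference of the two sides tends to $0$. *)

(* Defs.v *)
From HB Require Import structures.
From mathcomp Require Import all_boot all_order all_algebra.
From mathcomp Require Import complex.
From mathcomp Require Import all_classical all_reals all_analysis.

Set Implicit Arguments.
Unset Strict Implicit.
Unset Printing Implicit Defensive.

Import Order.TTheory GRing.Theory Num.Theory.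
Import numFieldNormedType.Exports.
Local Open Scope ring_scope.
Local Open Scope complex_scope.
Local Open Scope sesquilinear_scope.

Definition log2 (R : realType) (x : R) : R := ln x / ln 2.

(* The Euclidean norm, real-valued. The norm that MathComp-Analysis puts on
   matrices is the sup norm, and the norm of R[i] itself takes values in R[i];
   Normc.normc is the R-valued modulus. *)
Definition l2norm (R : realType) (M : nat) (v : 'cV[R[i]]_M) : R :=
  Num.sqrt (\sum_(i < M) Normc.normc (v i 0) ^+ 2).

Definition sensing_rate (R : realType) (M N L : nat) (alpha_s p : R)
    (h_s w : 'cV[R[i]]_M) : R :=
  L%:R^-1 *
  log2 (1 + p * N%:R * L%:R * alpha_s * Normc.normc ((w^t* *m h_s) 0 0) ^+ 2).

Definition maximizes_on_unit_sphere (R : realType) (M : nat)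
    (f : 'cV[R[i]]_M -> R) (w0 : 'cV[R[i]]_M) : Prop :=
  l2norm w0 = 1 /\ forall w : 'cV[R[i]]_M, l2norm w = 1 -> f w <= f w0.

Definition sensing_beamformer (R : realType) (M : nat) (h_s : 'cV[R[i]]_M) :
    'cV[R[i]]_M :=
  ((l2norm h_s)^-1)%:C *: h_s.

Definition sensing_centric_rate (R : realType) (M N L : nat) (alpha_s p : R)
    (h_s : 'cV[R[i]]_M) : R :=
  sensing_rate N L alpha_s p h_s (sensing_beamformer h_s).

(* Main.v *)
(** By Cauchy-Schwarz, |w^H h| <= |w| |h|, with equality at w = h / |h|, and the
    rate increases with |w^H h|. The asymptotics hold because, with
    c = N L alpha |h|^2, ln (1 + p c) - ln p - ln c = ln (1 + 1 / (p c)) -> 0. *)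
Require Import Defs.
From mathcomp Require Import all_boot all_order all_algebra.
From mathcomp Require Import complex.
From mathcomp Require Import all_classical all_reals all_analysis.
Import Order.TTheory GRing.Theory Num.Theory.
Import numFieldNormedType.Exports.
Local Open Scope classical_set_scope.
Local Open Scope ring_scope.

(** True by conversion; it lets facts about the [R[i]]-valued norm be carried over to the real
    modulus. *)
Lemma normc_norm (R : rcfType) (z : R[i]) : (Normc.normc z)%:C%C = `|z|.
Proof. by []. Qed.

Lemma l2norm_ge0 (R : realType) (M : nat) (v : 'cV[R[i]]_M) : 0 <= l2norm v.
Proof. exact: sqrtr_ge0. Qed.

Lemma sqr_l2norm (R : realType) (M : nat) (v : 'cV[R[i]]_M) :
  l2norm v ^+ 2 = \sum_(i < M) Normc.normc (v i 0) ^+ 2.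
Proof. by rewrite sqr_sqrtr // sumr_ge0 // => i _; exact: sqr_ge0. Qed.

(** By contraposition: a vanishing sum of nonnegative squares forces every entry to vanish. *)
Lemma l2norm_gt0 (R : realType) (M : nat) (v : 'cV[R[i]]_M) :
  v != 0 -> 0 < l2norm v.
Proof.
move=> v0; rewrite lt_neqAle l2norm_ge0 andbT eq_sym.
apply: contra v0 => /eqP n0; apply/eqP/matrixP => i j.
have /psumr_eq0P : \sum_(i < M) Normc.normc (v i 0) ^+ 2 = 0.
  by rewrite -sqr_l2norm n0 expr0n.
move=> /(_ (fun _ _ => sqr_ge0 _)) /(_ i isT) /eqP.
by rewrite sqrf_eq0 (ord1 j) mxE => /eqP/Normc.eq0_normc.
Qed.

Lemma l2normZ (R : realType) (M : nat) (c : R[i]) (v : 'cV[R[i]]_M) :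
  l2norm (c *: v) = Normc.normc c * l2norm v.
Proof.
have c0 : 0 <= Normc.normc c by rewrite -lecR normc_norm; exact: normr_ge0.
rewrite -[Normc.normc c]ger0_norm // -sqrtr_sqr -sqrtrM ?sqr_ge0 // mulr_sumr.
by congr Num.sqrt; apply: eq_bigr => i _; rewrite mxE Normc.normcM exprMn.
Qed.

Lemma sqr_l2norm_inner (R : realType) (M : nat) (v : 'cV[R[i]]_M) :
  (map_mx Num.conj v^T *m v) 0 0 = (l2norm v ^+ 2)%:C%C.
Proof.
rewrite sqr_l2norm rmorph_sum mxE; apply: eq_bigr => i _ /=.
by rewrite !mxE rmorphXn /= normc_norm normCK mulrC.
Qed.

Lemma normc_inner_le (R : realType) (M : nat) (w h : 'cV[R[i]]_M) :
  Normc.normc ((map_mx Num.conj w^T *m h) 0 0) ^+ 2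
    <= l2norm w ^+ 2 * l2norm h ^+ 2.
Proof.
have conjK (v : 'cV[R[i]]_M) : map_mx Num.conj (map_mx Num.conj v^T)^T = v.
  by apply/matrixP => i j; rewrite !mxE conjCK.
(* [dotmx] pairs row vectors and conjugates its second argument, so it is applied to the conjugate
   transposes: by [conjK] the pairing becomes $w^H h$. The equality case is discarded. *)
have [] := @CauchySchwarz _ _ (@dotmx R[i] M) (map_mx Num.conj w^T)
  (map_mx Num.conj h^T).
rewrite /= !dotmxE !conjK !sqr_l2norm_inner -normc_norm => + _.
by rewrite -rmorphXn -rmorphM lecR.
Qed.

Lemma normc_real_ge0 (R : rcfType) (x : R) : 0 <= x -> Normc.normc x%:C%C = x.
Proof. by move=> x0; apply: complexI; rewrite normc_norm ger0_norm // lecR. Qed.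

Lemma l2norm_sensing_beamformer (R : realType) (M : nat) (h : 'cV[R[i]]_M) :
  h != 0 -> l2norm (sensing_beamformer h) = 1.
Proof.
move=> /l2norm_gt0 h0.
by rewrite l2normZ normc_real_ge0 ?invr_ge0 ?l2norm_ge0 // mulVf ?gt_eqF.
Qed.

Lemma normc_sensing_beamformer (R : realType) (M : nat) (h : 'cV[R[i]]_M) :
  h != 0 ->
  Normc.normc ((map_mx Num.conj (sensing_beamformer h)^T *m h) 0 0) = l2norm h.
Proof.
move=> /l2norm_gt0 h0.
rewrite /sensing_beamformer linearZ /= map_mxZ -scalemxAl mxE sqr_l2norm_inner.
(* The scalar comes out conjugated but is real, which leaves $|h|^{-1} |h|^2 = |h|$. *)
rewrite Normc.normcM [X in Normc.normc X * _](_ : _ = ((l2norm h)^-1)%:C%C).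
  by rewrite !normc_real_ge0 ?invr_ge0 ?sqr_ge0 ?ltW // expr2 mulKf ?gt_eqF.
exact: conjc_real.
Qed.

Lemma ln2_gt0 (R : realType) : 0 < ln (2 : R).
Proof. by rewrite ln_gt0 // ltr1n. Qed.

Lemma ler_log2 (R : realType) (x y : R) : 0 < x -> x <= y -> log2 x <= log2 y.
Proof.
move=> x0 xy; rewrite /log2 ler_pM2r ?invr_gt0 ?ln2_gt0 //.
by rewrite ler_ln ?posrE // (lt_le_trans x0).
Qed.

Lemma cvg_log2_shift (R : realType) (c : R) : 0 < c ->
  log2 (1 + p * c) - (log2 p + log2 c) @[p --> +oo] --> (0 : R).
Proof.
move=> c0.
(* The laws of the logarithm are applied to positive arguments, so the identity is stated for large
   [p]; eventual equality suffices to transfer the limit. *)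
have /near_eq_cvg H : \forall p \near +oo,
    ln (1 + (p * c)^-1) / ln 2 = log2 (1 + p * c) - (log2 p + log2 c) :> R.
  near=> p.
  have p0 : 0 < p by near: p; exact: nbhs_pinfty_gt.
  have pc0 : 0 < p * c by rewrite mulr_gt0.
  rewrite /log2 -mulrDl -mulrBl -lnM ?posrE // -ln_div ?posrE ?addr_gt0 //.
  by rewrite mulrDl mul1r divff ?gt_eqF // addrC.
apply: cvg_trans H _.
(* Writing 0 as [ln 1 / ln 2] reduces the limit to continuity of [ln] at 1. *)
suff : ln (1 + (p * c)^-1) / ln 2 @[p --> +oo] --> (ln 1 / ln 2 : R).
  by rewrite ln1 mul0r.
apply: cvgMr_tmp.
apply: (@cvg_comp _ _ _ (fun p : R => 1 + (p * c)^-1) (@ln R) _ (nbhs (1 : R))).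
  suff : 1 + (p * c)^-1 @[p --> +oo] --> (1 + 0 : R) by rewrite addr0.
  apply: cvgD; first exact: cvg_cst.
  apply/gtr0_cvgV0; last by apply: gt0_cvgMly => //; exact: cvg_id.
  by near=> p; rewrite mulr_gt0 //; near: p; exact: nbhs_pinfty_gt.
exact: continuous_ln.
Unshelve. all: by end_near. Qed.

Theorem theorem4 (R : realType) (M N L : nat) (alpha_s : R)
    (h_s : 'cV[R[i]]_M)
    (hM : (1 <= M)%N) (hN : (1 <= N)%N) (hL : (1 <= L)%N)
    (halpha : 0 < alpha_s) (hh : h_s != 0) :
  (forall p : R, 0 < p ->
     maximizes_on_unit_sphere (sensing_rate N L alpha_s p h_s)
       (sensing_beamformer h_s)
     /\ sensing_centric_rate N L alpha_s p h_s
        = L%:R^-1 * log2 (1 + p * N%:R * L%:R * alpha_s * l2norm h_s ^+ 2))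
  /\ (sensing_centric_rate N L alpha_s p h_s
      - L%:R^-1 * (log2 p + log2 (N%:R * L%:R * alpha_s * l2norm h_s ^+ 2)))
     @[p --> +oo] --> (0 : R).
Proof.
have HH : 0 < l2norm h_s ^+ 2 by rewrite exprn_gt0 ?l2norm_gt0.
have N0 : 0 < N%:R :> R by rewrite ltr0n.
have L0 : 0 < L%:R :> R by rewrite ltr0n.
(* Stated for every real [p], so that it also rewrites under the binder of the limit. *)
have eqrate p : sensing_centric_rate N L alpha_s p h_s
    = L%:R^-1 * log2 (1 + p * N%:R * L%:R * alpha_s * l2norm h_s ^+ 2).
  by rewrite /sensing_centric_rate /sensing_rate normc_sensing_beamformer.
split=> [p p0|].
  split; last exact: eqrate.
  split=> [|w w1]; first exact: l2norm_sensing_beamformer.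
  (* With the maximum in closed form and the factor [L%:R^-1] cancelled, monotonicity of [log2]
     leaves Cauchy-Schwarz with $|w| = 1$. *)
  rewrite [leRHS]eqrate /sensing_rate ler_pM2l ?invr_gt0//.
  have c0 : 0 <= p * N%:R * L%:R * alpha_s by rewrite !mulr_ge0 // ltW.
  apply: ler_log2; first by rewrite ltr_wpDr // mulr_ge0 ?sqr_ge0.
  rewrite lerD2l ler_wpM2l //.
  by have := normc_inner_le _ _ w h_s; rewrite w1 expr1n mul1r.
set C := N%:R * L%:R * alpha_s * l2norm h_s ^+ 2.
have C0 : 0 < C by do 3 (apply: mulr_gt0 => //).
have eqC p : p * N%:R * L%:R * alpha_s * l2norm h_s ^+ 2 = p * C.
  by rewrite /C !mulrA.
(* The limit 0 is written as a multiple of [L%:R^-1] to match the common factor of the two rates. *)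
rewrite -(mulr0 L%:R^-1).
under eq_fun do rewrite eqrate -mulrBr eqC.
by apply: cvgMl_tmp; exact: cvg_log2_shift.
Qed.
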